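(* For every countable abelian group $G$ without torsion there exists $\omega\in\mathbb{R}^{\mathbb{N}}$, i.e. a Kronecker flow $(\mathbb{T}^{\mathbb{N}},\Phi_\omega)$, such that $G$ is isomorphic to the frequency module $\mathscr{M}_\omega$.
   Context: $\mathbb{N}=\{1,2,\dots\}$. $\mathbb{Z}^{(\mathbb{N})}$ is the group of finitely supported integer sequences. For $\omega=(\omega_j)_{j\in\mathbb{N}}\in\mathbb{R}^{\mathbb{N}}$, the Kronecker flow on $\mathbb{T}^{\mathbb{N}}$ ($\mathbb{T}=\mathbb{R}/2\pi\mathbb{Z}$, product topology) is $\Phi_\omega^t(\theta)=(\Theta_j+\omega_jt+2\pi\mathbb{Z})_{j\in\mathbb{N}}$, where $\theta_j=\Theta_j+2\pi\mathbb{Z}$, and its frequency module is the additive subgroup $\mathscr{M}_\omega=\{\sum_j\omega_j\nu_j:\nu\in\mathbb{Z}^{(\mathbb{N})}\}$ of $\mathbb{R}$. An abelian group is without torsion if $ng=0$ with $n$ a non-zero integer implies $g=0$. *)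

(* Defs.v *)
From HB Require Import structures.
From mathcomp Require Import all_boot all_order all_algebra.
From mathcomp Require Import all_classical all_reals all_analysis.
Import Order.TTheory GRing.Theory Num.Theory.
Import numFieldNormedType.Exports.

Set Implicit Arguments.
Unset Strict Implicit.
Unset Printing Implicit Defensive.

Local Open Scope classical_set_scope.
Local Open Scope ring_scope.
Local Open Scope quotient_scope.

Definition torsion_free (G : zmodType) : Prop :=
  forall (n : int) (g : G), n != 0 -> g *~ n = 0 -> g = 0.

Section Torus.
Variable R : realType.

Definition two_pi_int : {pred R} :=
  [pred x | x \in [set y | exists n : int, y = 2 * pi * n%:~R]].

Fact two_pi_int_zmod_closed : zmod_closed two_pi_int.
Proof.
split; first by rewrite !inE; exists 0; rewrite mulr0.
move=> x y; rewrite !inE => -[m ->] [n ->].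
by exists (m - n); rewrite intrB mulrBr.
Qed.

HB.instance Definition _ :=
  GRing.isZmodClosed.Build R two_pi_int two_pi_int_zmod_closed.

Definition circle_quot := Quotient.quot two_pi_int.

Definition circle : topologicalType := @quotient_topology R circle_quot.

Definition to_circle (x : R) : circle := \pi_circle_quot x.

Lemma to_circleP (x y : R) :
  to_circle x = to_circle y <-> exists n : int, x - y = 2 * pi * n%:~R.
Proof.
have E : (x - y \in two_pi_int) = `[< exists n : int, x - y = 2 * pi * n%:~R >].
  by rewrite !inE.
split=> [xy|/asboolP].
  by apply/asboolP; rewrite -E Quotient.idealrBE; apply/eqP; exact: xy.
by rewrite -E Quotient.idealrBE => /eqP.
Qed.

(* Positions in sequences are counted from 0. *)
Definition infinite_torus : topologicalType :=
  prod_topology (fun _ : nat => circle).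

(* Kronecker flow with frequency vector omega, given through its values on
   classes of arbitrary representatives Theta. Since every point of the torus
   has representatives, this determines Phi. *)
Definition is_kronecker_flow (omega : nat -> R)
    (Phi : R -> infinite_torus -> infinite_torus) : Prop :=
  forall (t : R) (Theta : nat -> R),
    Phi t (fun j => to_circle (Theta j)) =
    fun j => to_circle (Theta j + omega j * t).

End Torus.

Definition finitely_supported (nu : nat -> int) : Prop :=
  finite_set [set j | nu j != 0].

Section FrequencyModule.
Variables (R : realType) (omega : nat -> R).

Definition frequency_set : set R :=
  [set x | exists2 nu : nat -> int, finitely_supported nu &
     x = \sum_(j \in [set: nat]) omega j * (nu j)%:~R].

Definition frequency_pred : {pred R} := [pred x | x \in frequency_set].

Fact frequency_zmod_closed : zmod_closed frequency_pred.
Proof.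
split.
  rewrite !inE; exists (fun=> 0).
    by apply: (sub_finite_set _ (finite_set0 nat)) => j /=.
  by rewrite fsbig1// => j _; rewrite mulr0.
move=> x y; rewrite !inE => -[mu mufin ->] [nu nufin ->].
pose D := [set j | mu j != 0] `|` [set j | nu j != 0].
have Dfin : finite_set D by rewrite finite_setU.
have sumD (la : nat -> int) : [set j | la j != 0] `<=` D ->
    \sum_(j \in [set: nat]) omega j * (la j)%:~R =
    \sum_(j \in D) omega j * (la j)%:~R.
  move=> laD; apply/esym/fsbig_widen => // j [_ /= jD].
  have [->|laj] := eqVneq (la j) 0; first by rewrite mulr0.
  by case: jD; exact: laD.
have subD : [set j | mu j - nu j != 0] `<=` D.
  move=> j /= h; have [mu0|] := eqVneq (mu j) 0; last by left.
  by right; move: h; rewrite /= mu0 sub0r oppr_eq0.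
exists (fun j => mu j - nu j); first exact: sub_finite_set Dfin.
rewrite !sumD//; [|by move=> j; right|by move=> j; left].
rewrite !fsbig_finite//= -sumrB; apply: eq_bigr => j _.
by rewrite intrB mulrBr.
Qed.

HB.instance Definition _ :=
  GRing.isZmodClosed.Build R frequency_pred frequency_zmod_closed.

Definition frequency_module : Type := {x : R | x \in frequency_pred}.

HB.instance Definition _ := SubChoice.on frequency_module.
HB.instance Definition _ := [SubChoice_isSubZmodule of frequency_module by <:].

End FrequencyModule.

(* Main.v *)
Require Import Defs.
From HB Require Import structures.
From mathcomp Require Import all_boot all_order all_algebra.
From mathcomp Require Import all_classical all_reals all_analysis.
Import GRing.Theory Num.Theory.

Local Open Scope classical_set_scope.
Local Open Scope ring_scope.

(** A flow exists for every frequency vector, since reals that represent the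
    same point of the circle have translates that represent the same point
    ([kronecker_flow_exists]). If [f] embeds [G] in the additive group of the
    reals and [e] enumerates [G], then the frequency module of
    [omega j = f (e j)] is the subgroup generated by the image of [f], which is
    that image. So the theorem says that a countable torsion-free group embeds
    in the reals ([torsion_free_countable_embedding]).

    The embedding is obtained by Zorn's lemma on graphs of isomorphisms between
    subgroups of [G] and subgroups of the reals. Such a graph can always be
    extended to one more element [g]. If a non-zero multiple [n g] is in the
    domain already, with image [x], then the image of [g] must be [x / n], and
    absence of torsion makes the extension injective. Otherwise any real
    outside the divisible hull of the range is a possible image, and one
    exists because the range is countable while the reals are not. *)

(** * Extending isomorphisms between subgroups *)

Section PartialIsomorphisms.
Variables U V : zmodType.
Implicit Types (A B : set (U * V)) (g : U) (y : V).

(** Closure under subtraction makes the second clause, which concerns 0 only,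
    say that the relation and its inverse are both single-valued. The empty
    relation is admitted, as the union of the empty chain. *)
Definition partial_isomorphism A : Prop :=
  (forall p q, A p -> A q -> A (p - q)) /\
  (forall p, A p -> (p.1 = 0 <-> p.2 = 0)).

(** The image of [g] may be declared to be [y] without breaking either
    single-valuedness or injectivity. *)
Definition compatible_value A g y : Prop :=
  forall p (k : int), A p -> (p.1 + g *~ k = 0 <-> p.2 + y *~ k = 0).

Lemma partial_isomorphism_adjoin A g y :
  partial_isomorphism A -> compatible_value A g y ->
  partial_isomorphism
    [set r | exists p (k : int), A p /\ r = (p.1 + g *~ k, p.2 + y *~ k)].
Proof.
move=> [Asub _] gy; split.
  move=> _ _ [p [k [Ap ->]]] [q [l [Aq ->]]].
  exists (p - q), (k - l); split; first exact: Asub.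
  by congr pair; rewrite /= mulrzBr opprD addrACA.
by move=> _ [p [k [Ap ->]]] /=; exact: gy.
Qed.

Lemma partial_isomorphism_bigcup (F : set (set (U * V))) :
  F `<=` partial_isomorphism -> total_on F subset ->
  partial_isomorphism (\bigcup_(A in F) A).
Proof.
move=> Fiso Ftot; split=> [p q [A FA Ap] [B FB Bq]|p [A FA Ap]]; last first.
  exact: (Fiso _ FA).2.
have [AB|BA] := Ftot _ _ FA FB.
- by exists B => //; apply: (Fiso _ FB).1 => //; exact: AB.
- by exists A => //; apply: (Fiso _ FA).1 => //; exact: BA.
Qed.

(** Adjoining [(0, 0)] preserves partial isomorphisms, so a maximal one is not
    empty. *)
Lemma maximal_partial_isomorphism0 A :
  partial_isomorphism A ->
  (forall B, A `<` B -> ~ partial_isomorphism B) -> A 0.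
Proof.
move=> [Asub A0] Amax; apply: contrapT => nA0.
apply: (Amax (0 |` A)).
  split; first exact: subsetUr.
  by move=> /(_ 0 (or_introl erefl)).
split=> [p q [->|Ap] [->|Aq]|p [->|Ap]].
- by left; rewrite subrr.
- by right; rewrite -(subrr q); exact: Asub (Asub _ _ Aq Aq) Aq.
- by right; rewrite subr0.
- by right; exact: Asub.
- by [].
- exact: A0.
Qed.

(** A maximal partial isomorphism has full domain, since it could otherwise be
    adjoined a pair [(g, y)]; it is then the graph of an embedding. *)
Lemma embedding_of_compatible_values :
  (forall A g, partial_isomorphism A -> exists y, compatible_value A g y) ->
  exists f : {additive U -> V}, injective f.
Proof.
move=> ext.
have [A [Aiso Amax]] := Zorn_bigcup partial_isomorphism_bigcup.
have A0 := maximal_partial_isomorphism0 _ Aiso Amax.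
have total g : exists y, A (g, y).
  have [y gy] := ext A g Aiso; exists y; apply: contrapT => nAgy.
  apply: (Amax _ _ (partial_isomorphism_adjoin _ _ _ Aiso gy)).
  split=> [[h x] Ahx|sub].
    by exists (h, x), 0; rewrite /= !mulr0z !addr0.
  by apply: nAgy; apply: sub; exists 0, 1; rewrite /= !mulr1z !add0r.
have [f Af] := boolp.choice total.
have [Asub Azero] := Aiso.
have fB : zmod_morphism f.
  move=> g h; apply/eqP; rewrite -subr_eq0; apply/eqP.
  have := Asub _ _ (Af (g - h)) (Asub _ _ (Af g) (Af h)).
  by move=> /Azero /= [+ _]; apply; rewrite subrr.
pose fM := GRing.isZmodMorphism.Build U V f fB.
pose fA : {additive U -> V} := HB.pack f fM.
exists fA => g h fgh; apply/eqP; rewrite -subr_eq0; apply/eqP.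
apply: (Azero _ (Asub _ _ (Af g) (Af h))).2.
by rewrite /= -[f]/(fA : U -> V) fgh subrr.
Qed.

End PartialIsomorphisms.

Arguments partial_isomorphism {U V} A.
Arguments compatible_value {U V} A g y.

(** * Embedding in the real numbers *)

(** A countable set is Lebesgue null, whereas the unit interval is not. *)
Lemma exists_notin_countable (R : realType) (A : set R) :
  countable A -> exists y, ~ A y.
Proof.
move=> Acount; apply: contrapT => /forallNP allA.
have := lebesgue_measure_itv (R := R) `[0, 1].
rewrite countable_lebesgue_measure0; last first.
  apply: sub_countable Acount; apply: subset_card_le => x _.
  exact: contrapT (allA x).
by rewrite /= lte_fin ltr01 oppr0 adde0 => /eqP; rewrite eq_sym onee_eq0.
Qed.

(** Single-valuedness makes the first projection injective on the graph. *)
Lemma partial_isomorphism_countable_range (U V : zmodType) (A : set (U * V)) :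
  countable [set: U] -> partial_isomorphism A -> countable [set p.2 | p in A].
Proof.
move=> Ucount [Asub A0].
have A2 : countable A.
  have [i iinj] := countable_injP _ Ucount.
  apply/countable_injP; exists (i \o fst) => p q /set_mem Ap /set_mem Aq /= pq.
  have {}pq : p.1 = q.1 by apply: iinj pq; rewrite in_setT.
  have /subr0_eq pq2 : (p - q).2 = 0.
    by apply/(A0 _ (Asub _ _ Ap Aq)); rewrite /= pq subrr.
  by apply/eqP; rewrite -pair_eqE /= pq pq2 !eqxx.
exact: card_le_trans (card_image_le _ _) A2.
Qed.

(** The image of [g] is forced when a non-zero multiple of [g] is in the domain;
    when no such multiple exists, any real without a non-zero multiple in the
    range will do, and countability of the range provides one. *)
Lemma compatible_value_exists (R : realType) (G : zmodType)
    (A : set (G * R)) (g : G) :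
  countable [set: G] -> torsion_free G -> partial_isomorphism A ->
  exists y, compatible_value A g y.
Proof.
move=> G_countable G_torsion_free Aiso; have [Asub A0] := Aiso.
have AD p q : A p -> A q -> A (p + q).
  move=> Ap Aq; rewrite -[q]opprK -(sub0r q) -(subrr q).
  exact: Asub Ap (Asub _ _ (Asub _ _ Aq Aq) Aq).
have Azero p : A p -> A 0 by move=> Ap; rewrite -(subrr p); exact: Asub.
have AM p k : A p -> A (p *~ k).
  move=> Ap; have AMn n : A (p *+ n).
    elim: n => [|n IH]; first exact: Azero Ap.
    by rewrite mulrS; exact: AD.
  case: k => n; rewrite ?NegzE ?mulrNz; first exact: AMn.
  by rewrite -sub0r; apply: Asub; [exact: Azero Ap|exact: AMn].
have tfR (n : int) (x : R) : n != 0 -> x *~ n = 0 -> x = 0.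
  by move=> n0 /eqP; rewrite mulrz_eq0 (negbTE n0) => /eqP.
have [[n [q [n0 Aq ng]]]|ind] :=
  pselect (exists (n : int) q, [/\ n != 0, A q & q.1 = g *~ n]).
  have nR : n%:~R != 0 :> R by rewrite intr_eq0.
  exists (q.2 / n%:~R) => p k Ap.
  have yn : (q.2 / n%:~R) *~ n = q.2 by rewrite -mulrzr divfK.
  (* After multiplication by n, both sums are coordinates of the single point
     n p + k q of A, so they vanish together. *)
  have [to2 to1] := A0 _ (AD _ _ (AM p n Ap) (AM q k Aq)).
  have E1 : (p.1 + g *~ k) *~ n = (p *~ n + q *~ k).1.
    rewrite /= mulrzDl !(raddfMz (fst : {additive G * R -> G})) /= ng.
    by rewrite -!mulrzA (mulrC k).
  have E2 : (p.2 + (q.2 / n%:~R) *~ k) *~ n = (p *~ n + q *~ k).2.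
    rewrite /= mulrzDl !(raddfMz (snd : {additive G * R -> R})) /=.
    by rewrite -[in RHS]yn -!mulrzA (mulrC k).
  split=> E.
    by apply: (tfR n) => //; rewrite E2; apply: to2; rewrite -E1 E mul0rz.
  apply: (G_torsion_free n) => //; rewrite E1; apply: to1.
  by rewrite -E2 E mul0rz.
(* The reals to avoid are the quotients x / k with x in the range of A. *)
have [y yA] : exists y : R,
    ~ (exists (k : int) p, [/\ k != 0, A p & y *~ k = p.2]).
  apply: exists_notin_countable.
  have count2 : countable ([set p.2 | p in A] `*` [set: int]).
    apply: countableX; last exact: countableP.
    exact: partial_isomorphism_countable_range.
  apply: sub_countable (card_le_trans (card_image_le
    (fun xk : R * int => xk.1 / xk.2%:~R) _) count2).
  apply: subset_card_le => x [k [p [k0 Ap xk]]].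
  exists (p.2, k); first by split => //; exists p.
  by rewrite /= -xk -mulrzr mulfK // intr_eq0.
exists y => p k Ap.
(* For k non-zero neither equation holds: the first would put a multiple of g in
   the domain, the second a multiple of y in the range. *)
have [->|k0] := eqVneq k 0; first by rewrite !mulr0z !addr0; exact: A0.
have ANp : A (- p) by rewrite -sub0r; apply: Asub => //; exact: Azero Ap.
split=> /eqP; rewrite addrC addr_eq0 => /eqP E; exfalso.
- by apply: ind; exists k, (- p); split.
- by apply: yA; exists k, (- p); split.
Qed.

Lemma torsion_free_countable_embedding (R : realType) (G : zmodType) :
  countable [set: G] -> torsion_free G ->
  exists f : {additive G -> R}, injective f.
Proof.
move=> G_countable G_torsion_free.
by apply: embedding_of_compatible_values => A g; exact: compatible_value_exists.
Qed.

(** * Kronecker flows and their frequency modules *)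

Lemma kronecker_flow_exists (R : realType) (omega : nat -> R) :
  exists Phi, is_kronecker_flow omega Phi.
Proof.
exists (fun t theta j =>
  to_circle (repr (theta j : circle_quot R) + omega j * t)).
move=> t Theta; apply/funext => j; apply/to_circleP.
rewrite opprD addrACA subrr addr0; apply/to_circleP.
exact: (reprK (to_circle (Theta j) : circle_quot R)).
Qed.

Lemma frequency_set_image (R : realType) (G : zmodType) (f : {additive G -> R})
    (e : nat -> G) : set_surj [set: nat] [set: G] e ->
  frequency_set (f \o e) = range f.
Proof.
move=> esurj; apply/seteqP; split=> [_ [nu _ ->]|_ [g _ <-]].
  (* Summation over the same list of indices as in the real sum lets f commute
     with it term by term. *)
  exists (\sum_(j <- finite_support 0 [set: nat]
      (fun j => (f \o e) j * (nu j)%:~R)) e j *~ nu j) => //.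
  by rewrite raddf_sum; apply: eq_bigr => j _; rewrite raddfMz mulrzr.
have [j _ <-] := esurj g I.
exists (fun i => (i == j)%:Z).
  apply: (sub_finite_set _ (finite_set1 j)) => i /=.
  by have [->|] := eqVneq i j; rewrite ?eqxx.
rewrite -(fsbig_widen [set j]) //=.
  by rewrite fsbig_set1 eqxx mulr1.
by move=> i [_ /eqP /negbTE ij] /=; rewrite ij mulr0.
Qed.

Theorem mainTheorem6 (R : realType) (G : zmodType)
    (G_countable : countable [set: G]) (G_torsion_free : torsion_free G) :
  exists (omega : nat -> R) (Phi : R -> infinite_torus R -> infinite_torus R),
    is_kronecker_flow omega Phi /\
    exists f : {additive G -> frequency_module omega}, bijective f.
Proof.
have [f finj] :=
  torsion_free_countable_embedding R G G_countable G_torsion_free.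
have [e esurj] : exists e : nat -> G, set_surj [set: nat] [set: G] e.
  exact/pcard_surjP.
have [Phi Phiflow] := kronecker_flow_exists R (f \o e).
exists (f \o e), Phi; split=> //.
have fin g : f g \in frequency_pred (f \o e).
  by apply/mem_set; rewrite frequency_set_image //; exists g.
pose F g : frequency_module (f \o e) := exist _ (f g) (fin g).
have FB : zmod_morphism F by move=> g h; apply: val_inj; rewrite /= raddfB.
pose FM := GRing.isZmodMorphism.Build G _ F FB.
pose FA : {additive G -> frequency_module (f \o e)} := HB.pack F FM.
exists FA.
have preimage x : exists g, F g = x.
  have : frequency_set (f \o e) (val x) by exact: set_mem (valP x).
  rewrite frequency_set_image // => -[g _ fg].
  by exists g; exact: val_inj.
have [h Fh] := boolp.choice preimage.
exists h => [g|x]; last exact: Fh.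
by apply: finj; exact: (congr1 val (Fh (F g))).
Qed.
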